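(* Regard $$\gamma=\gamma(p)=\frac{\alpha\lambda^2(1-p)}{2n^2p}+\max\left\{\frac{L_f}{1-p},\ \frac{\lambda}{n}\left(1+\frac{4(1-p)}{p}\right)\right\}$$ as a function of $p\in(0,1)$, and let $L:=nL_f$. The probability $p^*$ minimizing $\gamma$ over $(0,1)$ is equal to $\max\{p_e,p_A\}$, where $$p_e=\frac{7\lambda+L-\sqrt{\lambda^2+14\lambda L+L^2}}{6\lambda}$$ and $p_A$ is the minimizer in $(0,1)$ of the function $A(p)=\frac{\alpha\lambda^2}{2n^2p}+\frac{L}{n(1-p)}$.
   Context: $n\ge1$ is an integer (number of devices), $\lambda>0$ is the penalty parameter, $L_f>0$ and $\mu>0$ are the smoothness and strong convexity constants of a function $f$, and $\alpha=\frac{4\left(4\omega+4\omega_M(1+\omega)\right)}{\mu}$, where $\omega=\max_i\omega_i>0$ and $\omega_M\ge0$ are variance constants of compression operators; in particular $\alpha>0$ and $\alpha$ does not depend on $p$. *)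

(* Defs.v *)
From mathcomp Require Import all_boot all_order all_algebra.
From mathcomp Require Import classical_sets set_interval reals.

Set Implicit Arguments.
Unset Strict Implicit.
Unset Printing Implicit Defensive.

Import Order.TTheory GRing.Theory Num.Theory.
Local Open Scope classical_set_scope.
Local Open Scope ring_scope.

Section Defs.
Context {R : realType}.
Implicit Types (lam Lf mu alpha omega omegaM p : R) (n : nat).

Definition minimizers (D : set R) (f : R -> R) : set R :=
  [set p | D p /\ forall q, D q -> f p <= f q].

(* The base value 0 is immaterial: whenever the result is positive, it is the
   maximum of the [omegas i]. *)
Definition omega_max n (omegas : 'I_n -> R) : R :=
  \big[Num.max/0]_(i < n) omegas i.

Definition alpha_const mu omega omegaM : R :=
  4 * (4 * omega + 4 * omegaM * (1 + omega)) / mu.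

Definition gamma alpha lam Lf n p : R :=
  alpha * lam ^+ 2 * (1 - p) / (2 * n%:R ^+ 2 * p)
  + Num.max (Lf / (1 - p)) (lam / n%:R * (1 + 4 * (1 - p) / p)).

Definition p_e lam (L : R) : R :=
  (7 * lam + L - Num.sqrt (lam ^+ 2 + 14 * lam * L + L ^+ 2)) / (6 * lam).

Definition A_fun alpha lam (L : R) n p : R :=
  alpha * lam ^+ 2 / (2 * n%:R ^+ 2 * p) + L / (n%:R * (1 - p)).

End Defs.

(* Main.v *)
(** Up to the additive constant [a = alpha * lam^2 / (2 * n^2)], [gamma] is the
    maximum of [A p = a / p + Lf / (1 - p)] and [B p = a / p + b * (4 / p - 3)]
    with [b = lam / n].  The function [B] is strictly decreasing, [A] is
    strictly decreasing up to [p_A] and strictly increasing after it, and [A - B]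
    has the sign of [p - p_e], since [p_e] is the smaller root of
    [3 lam p^2 - (7 lam + L) p + 4 lam] and the larger root exceeds 1.  So to the
    right of [max p_e p_A] the bound [A] increases, and to the left of it either
    [A] exceeds its minimum or [B] exceeds its value at the crossing [p_e]. *)
Require Import Defs.
From mathcomp Require Import all_boot all_order all_algebra.
From mathcomp Require Import classical_sets set_interval reals.
From mathcomp Require Import ring lra.
Import Order.TTheory GRing.Theory Num.Theory.
Local Open Scope classical_set_scope.
Local Open Scope ring_scope.

Lemma strict_minimizer (R : realType) (D : set R) (f : R -> R) (m : R) :
  D m -> (forall q, D q -> q != m -> f m < f q) -> minimizers D f = [set m].
Proof.
move=> Dm f_lt; apply/seteqP; split=> [p [Dp p_min]|_ ->].
  apply/eqP/negPn/negP => pm; have := f_lt p Dp pm.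
  by rewrite ltNge p_min.
split=> // q Dq; have [->//|qm] := eqVneq q m.
exact/ltW/f_lt.
Qed.

(** Here [y] stands for the crossing point of [A] and [B]. Equality there is asked only when
    [0 < y], since otherwise the maximum of [y] and [x] is [x]. *)
Lemma minimizers_max (R : realType) (A B : R -> R) (a x y : R) :
    0 < x < 1 -> y < 1 ->
    (forall q, 0 < q < x -> A x < A q) ->
    (forall p q, x <= p -> p < q < 1 -> A p < A q) ->
    (forall p q, 0 < p -> p < q < 1 -> B q < B p) ->
    (forall p, 0 < p < 1 -> y <= p -> B p <= A p) ->
    (0 < y -> B y = A y) ->
  minimizers `]0, 1[ A = [set x] /\
  minimizers `]0, 1[ (fun p => Num.max (A p) (B p) - a) = [set Num.max y x].
Proof.
move=> /andP[x0 x1] y1 A_left A_right B_decr B_le_A B_y; split.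
  apply: strict_minimizer => [|q]; first by rewrite /= in_itv /= x0 x1.
  rewrite /= in_itv /= => /andP[q0 q1]; rewrite neq_lt => /orP[qx|xq].
    by apply: A_left; rewrite q0.
  by apply: A_right; rewrite ?xq.
set m := Num.max y x.
have xm : x <= m by rewrite le_max lexx orbT.
have ym : y <= m by rewrite le_max lexx.
have m1 : m < 1 by rewrite gt_max y1.
have m0 : 0 < m := lt_le_trans x0 xm.
apply: strict_minimizer => [|q]; first by rewrite /= in_itv /= m0 m1.
rewrite /= in_itv /= => /andP[q0 q1] qm.
(* Since [y <= m], the maximum at [m] is [A m]; it suffices that [A q] or [B q] exceeds it. *)
rewrite ltrD2r (max_idPl (B_le_A m _ ym)) ?m0// lt_max.
move: qm; rewrite neq_lt => /orP[qm|mq]; last by rewrite A_right ?mq.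
move: qm m0; rewrite /m; case: (leP y x) => [_ qx _|xy qy y0].
  by rewrite A_left ?q0.
by rewrite -B_y// B_decr ?qy ?orbT.
Qed.

(** The difference of the two sums is that of the two products times a positive factor containing
    [q - p]. No sign of [a] or [l] is assumed, so both can be negated to reverse the inequality. *)
Lemma inv_sum_ltP (R : realFieldType) (a l p q : R) :
    0 < p -> p < q -> q < 1 ->
  (a / p + l / (1 - p) < a / q + l / (1 - q)) =
  (a * (1 - q) * (1 - p) < l * q * p).
Proof.
move=> p0 pq q1; rewrite -subr_gt0 -[RHS]subr_gt0.
have -> : a / q + l / (1 - q) - (a / p + l / (1 - p)) =
    (l * q * p - a * (1 - q) * (1 - p)) *
    ((q - p) / (p * q * ((1 - p) * (1 - q)))).
  by field; rewrite !gt_eqF//; lra.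
by rewrite pmulr_lgt0// divr_gt0 ?mulr_gt0//; lra.
Qed.

Lemma inv_sum_gtP (R : realFieldType) (a l p q : R) :
    0 < p -> p < q -> q < 1 ->
  (a / q + l / (1 - q) < a / p + l / (1 - p)) =
  (l * q * p < a * (1 - q) * (1 - p)).
Proof.
move=> p0 pq q1; have := @inv_sum_ltP _ (- a) (- l) p q p0 pq q1.
by rewrite !mulNr -!opprD !ltrN2.
Qed.

Lemma p_e_lt1 (R : realType) (lam L : R) : 0 < lam -> 0 < L -> p_e lam L < 1.
Proof.
move=> lam0 L0; rewrite /p_e ltr_pdivrMr; last by lra.
have lamL : 0 < lam * L by rewrite mulr_gt0.
(* The squares of the two sides differ by [12 * lam * L]. *)
suff : lam + L < Num.sqrt (lam ^+ 2 + 14 * lam * L + L ^+ 2) by lra.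
rewrite -[ltLHS]ger0_norm -?sqrtr_sqr; last by lra.
by rewrite ltr_sqrt; nra.
Qed.

Lemma p_e_factor (R : realType) (lam L p : R) : 0 < lam -> 0 < L ->
  exists2 r, 1 < r &
    L * p - lam * ((4 - 3 * p) * (1 - p)) = 3 * lam * (p - p_e lam L) * (r - p).
Proof.
move=> lam0 L0; rewrite /p_e.
set D := _ + L ^+ 2.
have D0 : 0 <= D by rewrite /D; nra.
have sD : Num.sqrt D ^+ 2 = D by rewrite sqr_sqrtr.
have s0 := sqrtr_ge0 D.
exists ((7 * lam + L + Num.sqrt D) / (6 * lam)).
  by rewrite ltr_pdivlMr; lra.
move: (Num.sqrt D) sD s0 => s sD _.
have lam_neq0 : lam != 0 by rewrite gt_eqF.
have -> : 3 * lam * (p - (7 * lam + L - s) / (6 * lam)) *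
    ((7 * lam + L + s) / (6 * lam) - p) =
    (7 * lam + L) * p - 3 * lam * p ^+ 2 - ((7 * lam + L) ^+ 2 - s ^+ 2) / (12 * lam).
  by field.
(* Here [(7 * lam + L) ^+ 2 - D = 48 * lam ^+ 2], which yields the constant term [4 * lam]. *)
by rewrite sD /D; field.
Qed.

Theorem theorem3 (R : realType) (n : nat) (lam Lf mu omegaM : R)
    (omegas : 'I_n -> R)
    (hn : (1 <= n)%N) (hlam : 0 < lam) (hLf : 0 < Lf) (hmu : 0 < mu)
    (homega : 0 < omega_max omegas) (homegaM : 0 <= omegaM) :
  let alpha := alpha_const mu (omega_max omegas) omegaM in
  let L := n%:R * Lf in
  exists p_A : R,
    minimizers `]0, 1[ (A_fun alpha lam L n) = [set p_A] /\
    minimizers `]0, 1[ (gamma alpha lam Lf n) = [set Num.max (p_e lam L) p_A].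
Proof.
move=> alpha L.
have N0 : 0 < n%:R :> R by rewrite ltr0n.
have L0 : 0 < L by rewrite mulr_gt0.
have alpha0 : 0 < alpha by rewrite /alpha /alpha_const divr_gt0//; nra.
clearbody alpha.
set a := alpha * lam ^+ 2 / (2 * n%:R ^+ 2).
have a0 : 0 < a by rewrite divr_gt0 ?mulr_gt0 ?exprn_gt0.
pose A p := a / p + Lf / (1 - p).
pose B p := a / p + lam / n%:R * (4 / p - 3).
have A_funE p : 0 < p < 1 -> A_fun alpha lam L n p = A p.
  move=> /andP[p0 p1]; rewrite /A_fun /A /L /a.
  by field; rewrite !gt_eqF//; lra.
have gammaE p : 0 < p < 1 -> gamma alpha lam Lf n p = Num.max (A p) (B p) - a.
  (* The first term of [gamma] is [a / p - a]; its part [a / p] enters both branches of the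
     maximum. *)
  move=> /andP[p0 p1]; rewrite /gamma /A /B -addr_maxr addrAC; congr (_ + _).
    by rewrite /a; field; rewrite !gt_eqF//; lra.
  by congr Num.max; field; rewrite !gt_eqF//; lra.
have minimizers_ext (f g : R -> R) : (forall p, 0 < p < 1 -> f p = g p) ->
    minimizers `]0, 1[ f = minimizers `]0, 1[ g.
  move=> fg; apply/seteqP; split=> p [Dp p_min]; split=> // q Dq;
    move: (Dp) (Dq) (p_min q Dq); rewrite /= !in_itv /= => p01 q01;
    by rewrite !fg.
rewrite (minimizers_ext _ _ A_funE) (minimizers_ext _ _ gammaE).
set r := Num.sqrt a; set s := Num.sqrt Lf.
have r0 : 0 < r by rewrite sqrtr_gt0.
have s0 : 0 < s by rewrite sqrtr_gt0.
have ar : a = r * r by rewrite -expr2 sqr_sqrtr ?ltW.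
have ls : Lf = s * s by rewrite -expr2 sqr_sqrtr ?ltW.
have BA p : 0 < p < 1 ->
    A p - B p = (L * p - lam * ((4 - 3 * p) * (1 - p))) / (n%:R * p * (1 - p)).
  move=> /andP[p0 p1]; rewrite /A /B /L.
  by field; rewrite !gt_eqF//; lra.
(* The critical point of [A]: [a / p ^+ 2 = Lf / (1 - p) ^+ 2] means [r * (1 - p) = s * p] on the
   interval. *)
set x := r / (r + s).
have x0 : 0 < x by rewrite divr_gt0 ?addr_gt0.
have x1 : x < 1 by rewrite ltr_pdivrMr; lra.
have xE : s * x = r * (1 - x) by rewrite /x; field; rewrite gt_eqF//; lra.
exists x; apply: minimizers_max; first by rewrite x0.
- exact: p_e_lt1.
- move=> q /andP[q0 qx]; rewrite /A inv_sum_gtP// ar ls.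
  (* Left of [x] the balance [xE] becomes this strict inequality; multiplying it by [xE] gives the
     goal. *)
  have sq : s * q < r * (1 - q) by nra.
  have sx0 : 0 < s * x by rewrite mulr_gt0.
  have -> : s * s * x * q = s * x * (s * q) by ring.
  have -> : r * r * (1 - x) * (1 - q) = s * x * (r * (1 - q)) by rewrite xE; ring.
  by rewrite ltr_pM2l.
- move=> p q xp /andP[pq q1]; have p0 := lt_le_trans x0 xp.
  rewrite /A inv_sum_ltP// ar ls.
  (* Only weak, as [p] may equal [x]; strictness of the product comes from [q]. *)
  have sp : r * (1 - p) <= s * p by nra.
  have sq : r * (1 - q) < s * q by nra.
  have rp0 : 0 < r * (1 - p) by rewrite mulr_gt0//; lra.
  have sq0 : 0 <= s * q by rewrite mulr_ge0//; lra.
  have -> : s * s * q * p = s * q * (s * p) by ring.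
  have -> : r * r * (1 - q) * (1 - p) = r * (1 - q) * (r * (1 - p)) by ring.
  by apply: lt_le_trans (ler_wpM2l sq0 sp); rewrite ltr_pM2r.
- move=> p q p0 /andP[pq q1]; have q0 := lt_trans p0 pq.
  have b0 : 0 < lam / n%:R by rewrite divr_gt0.
  have pq' : q^-1 < p^-1 by rewrite ltf_pV2.
  by rewrite /B ltrD// ltr_pM2l//; lra.
- move=> p p01 yp; rewrite -subr_ge0 BA//; case/andP: p01 => p0 p1.
  have [t t1 ->] := p_e_factor R lam L p hlam L0.
  by rewrite divr_ge0 ?mulr_ge0//; lra.
- move=> y0; apply/esym/eqP; rewrite -subr_eq0 BA ?y0 ?p_e_lt1//.
  have [t _ ->] := p_e_factor R lam L (p_e lam L) hlam L0.
  by rewrite subrr mulr0 !mul0r.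
Qed.
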